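(* Let $S\subseteq\mathbb R^n$ be a nonempty closed convex set, let $F\in\mathbb R^{n\times k}$ be as in the context, and let $\phi$ be an admissible Legendre regularizer for $S$. Let $\mathcal X\subseteq\mathbb R^{k_1}$ be compact and let $\mathcal G$ be a class of functions $g:\mathcal X\to\mathbb R^k$ such that for every continuous function $h:\mathcal X\to\mathbb R^k$ and every $\epsilon>0$ there exists $g\in\mathcal G$ with $$\sup_{x\in\mathcal X}\|g(x)-h(x)\|_2\le\epsilon.$$ Let $\pi:\mathcal X\to S$ be any continuous map (feasible policy). Then for every $\epsilon>0$ there exists $\hat\pi\in\Pi_{F,\phi}(\mathcal G)=\{w_{F,\phi}\circ g:g\in\mathcal G\}$ such that $$\sup_{x\in\mathcal X}\|\hat\pi(x)-\pi(x)\|_2\le\epsilon.$$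
   Context: Setting. $S\subseteq\mathbb R^n$ is a nonempty closed convex set with affine hull $\operatorname{aff}(S)=\{w\in\mathbb R^n:Aw=b\}$, where $A\in\mathbb R^{p\times n}$ has full row rank and $0\le p\le n-1$ (if $S$ is full-dimensional, $p=0$, $A$ is absent and $\operatorname{aff}(S)=\mathbb R^n$). $S^\circ$ denotes the relative interior of $S$ (and likewise $(\cdot)^\circ$ for other sets). Put $r=n-p$, let $N\in\mathbb R^{n\times r}$ be a matrix whose columns form an orthonormal basis of $\ker(A)$ (of $\mathbb R^n$ if $A$ is absent), and fix any $\bar w\in S^\circ$. Define $Y:=\{y\in\mathbb R^r:\bar w+Ny\in S^\circ\}$. Let $F\in\mathbb R^{n\times k}$ with $k\ge r$ and $B:=N^\top F\in\mathbb R^{r\times k}$, and assume $\operatorname{rank}(B)=r$. Admissible Legendre regularizer. For an extended-real-valued function $\phi$, $\operatorname{dom}(\phi)=\{w:\phi(w)<+\infty\}$. A proper lower semicontinuous convex function $\phi:\mathbb R^n\to\mathbb R\cup\{+\infty\}$ is an admissible Legendre regularizer for $S$ if $S^\circ=(\operatorname{dom}(\phi))^\circ$ and the reduced function $\psi(y):=\phi(\bar w+Ny)$ on $\mathbb R^r$ satisfies: (1) $\psi$ is $\mu$-strongly convex for some $\mu>0$; (2) $\psi$ is essentially smooth, i.e., $\psi$ is differentiable on $Y$, and $\lim_{i\to\infty}|\nabla\psi(y^i)|=+\infty$ for every sequence $\{y^i\}\subseteq Y$ converging to a boundary point of $Y$; (3) the convex conjugate $\psi^*(u)=\sup_{y}\{\langle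 u,y\rangle-\psi(y)\}$ is twice differentiable on $\mathbb R^r$. Solution map. For $z\in\mathbb R^k$, $w_{F,\phi}(z)\in\arg\min_{w\in\mathbb R^n}\{\langle Fz,w\rangle+\phi(w)\}$ (for an admissible Legendre regularizer this minimizer exists and is unique). The Legendre-regularized policy class is $\Pi_{F,\phi}(\mathcal G):=\{w_{F,\phi}\circ g:g\in\mathcal G\}$. *)

(* Defs.v *)
From HB Require Import structures.
From mathcomp Require Import all_boot all_order all_algebra.
From mathcomp Require Import all_classical all_reals all_analysis.

Set Implicit Arguments.
Unset Strict Implicit.
Unset Printing Implicit Defensive.

Import Order.TTheory GRing.Theory Num.Theory.
Import numFieldNormedType.Exports.

Local Open Scope classical_set_scope.
Local Open Scope ring_scope.

(* MathComp-Analysis; vectors of R^n are column vectors. The library norm on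
   'cV[R]_n is the max-norm: it induces the usual topology, but every norm that
   occurs in a formula below is the Euclidean one. *)

Definition dotcv (R : realType) (n : nat) (u v : 'cV[R]_n) : R :=
  \sum_(i < n) u i 0 * v i 0.

Definition l2norm (R : realType) (n : nat) (v : 'cV[R]_n) : R :=
  Num.sqrt (dotcv v v).

(* An extended real, so that no boundedness or nonemptiness is presupposed;
   it is -oo when X is empty. *)
Definition sup_dist (R : realType) (m n : nat) (X : set 'cV[R]_m)
    (f g : 'cV[R]_m -> 'cV[R]_n) : \bar R :=
  ereal_sup [set (l2norm (f x - g x))%:E | x in X].

Definition affine_hull (R : realType) (n : nat) (A : set 'cV[R]_n) :
    set 'cV[R]_n :=
  [set w | exists (m : nat) (x : 'I_m -> 'cV[R]_n) (t : 'I_m -> R),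
     [/\ forall i, A (x i), \sum_(i < m) t i = 1
       & w = \sum_(i < m) t i *: x i]].

Definition relint (R : realType) (n : nat) (A : set 'cV[R]_n) :
    set 'cV[R]_n :=
  [set w | A w /\ \forall v \near w, affine_hull A v -> A v].

Definition boundary (T : topologicalType) (A : set T) : set T :=
  closure A `\` interior A.

Definition orthonormal_kernel_basis (R : realType) (p n r : nat)
    (A : 'M[R]_(p, n)) (N : 'M[R]_(n, r)) : Prop :=
  N^T *m N = 1%:M /\ range (fun y : 'cV[R]_r => N *m y) = [set v | A *m v = 0].

(* Extended-real-valued functions. R U {+oo} is rendered by [\bar R] together
   with the exclusion of -oo, which is part of [eproper]. *)

Definition edom (R : realType) (T : Type) (f : T -> \bar R) : set T :=
  [set w | (f w < +oo)%E].

Definition eproper (R : realType) (T : Type) (f : T -> \bar R) : Prop :=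
  (forall w, f w != -oo%E) /\ edom f !=set0.

(* For functions without the value -oo the right-hand sides below are never of
   the form (+oo) + (-oo); recall also that 0 * (+oo) = 0 in \bar R. *)
Definition econvex (R : realType) (n : nat) (f : 'cV[R]_n -> \bar R) : Prop :=
  forall (x y : 'cV[R]_n) (t : R), 0 <= t <= 1 ->
    (f (t *: x + (1 - t) *: y)%R <= t%:E * f x + (1 - t)%:E * f y)%E.

Definition strongly_convex (R : realType) (n : nat) (mu : R)
    (f : 'cV[R]_n -> \bar R) : Prop :=
  forall (x y : 'cV[R]_n) (t : R), 0 <= t <= 1 ->
    (f (t *: x + (1 - t) *: y)%R <=
     t%:E * f x + (1 - t)%:E * f y
       - (mu / 2 * t * (1 - t) * l2norm (x - y) ^+ 2)%:E)%E.

Definition econjugate (R : realType) (n : nat) (f : 'cV[R]_n -> \bar R)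
    (u : 'cV[R]_n) : \bar R :=
  ereal_sup (range (fun y : 'cV[R]_n => ((dotcv u y)%:E - f y)%E)).

Definition gradient (R : realType) (n : nat) (f : 'cV[R]_n -> R)
    (x : 'cV[R]_n) : 'cV[R]_n :=
  \col_(i < n) 'd f x (delta_mx i 0).

Definition egradient (R : realType) (n : nat) (f : 'cV[R]_n -> \bar R) :
    'cV[R]_n -> 'cV[R]_n :=
  gradient (fine \o f).

(* [fine] sends +oo and -oo to 0, hence the explicit local finiteness. *)
Definition edifferentiable (R : realType) (n : nat) (f : 'cV[R]_n -> \bar R)
    (x : 'cV[R]_n) : Prop :=
  (\forall y \near x, f y \is a fin_num) /\ differentiable (fine \o f) x.

Definition twice_edifferentiable (R : realType) (n : nat)
    (f : 'cV[R]_n -> \bar R) (x : 'cV[R]_n) : Prop :=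
  (\forall y \near x, edifferentiable f y) /\ differentiable (egradient f) x.

Definition essentially_smooth (R : realType) (n : nat) (Y : set 'cV[R]_n)
    (f : 'cV[R]_n -> \bar R) : Prop :=
  (forall y, Y y -> edifferentiable f y) /\
  (forall (y_ : nat -> 'cV[R]_n) (y : 'cV[R]_n),
     (forall i, Y (y_ i)) -> boundary Y y -> y_ i @[i --> \oo] --> y ->
     l2norm (egradient f (y_ i)) @[i --> \oo] --> +oo).

Definition reduced_fun (R : realType) (n r : nat) (wbar : 'cV[R]_n)
    (N : 'M[R]_(n, r)) (phi : 'cV[R]_n -> \bar R) (y : 'cV[R]_r) : \bar R :=
  phi (wbar + N *m y).

Definition reduced_set (R : realType) (n r : nat) (wbar : 'cV[R]_n)
    (N : 'M[R]_(n, r)) (S : set 'cV[R]_n) : set 'cV[R]_r :=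
  [set y | relint S (wbar + N *m y)].

Definition admissible_legendre (R : realType) (n r : nat) (S : set 'cV[R]_n)
    (wbar : 'cV[R]_n) (N : 'M[R]_(n, r)) (phi : 'cV[R]_n -> \bar R) : Prop :=
  let psi := reduced_fun wbar N phi in
  [/\ [/\ eproper phi, lower_semicontinuous phi, econvex phi
        & relint S = relint (edom phi)],
      exists2 mu : R, 0 < mu & strongly_convex mu psi,
      essentially_smooth (reduced_set wbar N S) psi
    & forall u : 'cV[R]_r, twice_edifferentiable (econjugate psi) u].

Definition argmin (R : realType) (T : Type) (f : T -> \bar R) : set T :=
  [set w | forall v, (f w <= f v)%E].

(* For an admissible regularizer the set of minimizers is a singleton; [xget 0]
   picks its element (and returns 0 if the set is empty). *)
Definition solution_map (R : realType) (n k : nat) (F : 'M[R]_(n, k))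
    (phi : 'cV[R]_n -> \bar R) (z : 'cV[R]_k) : 'cV[R]_n :=
  xget 0 (argmin (fun w : 'cV[R]_n => ((dotcv (F *m z) w)%:E + phi w)%E)).

(* A function on X is represented by any total function extending it; only its
   values on X matter to [sup_dist]. *)
Definition policy_class (R : realType) (n k k1 : nat) (F : 'M[R]_(n, k))
    (phi : 'cV[R]_n -> \bar R) (G : set ('cV[R]_k1 -> 'cV[R]_k)) :
    set ('cV[R]_k1 -> 'cV[R]_n) :=
  [set solution_map F phi \o g | g in G].

(* Main.v *)
Require Import Defs.
From HB Require Import structures.
From mathcomp Require Import all_boot all_order all_algebra.
From mathcomp Require Import all_classical all_reals all_analysis.
From mathcomp Require Import lra.

Set Implicit Arguments.
Unset Strict Implicit.
Unset Printing Implicit Defensive.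
Import Order.TTheory GRing.Theory Num.Theory.
Import numFieldNormedType.Exports.
Local Open Scope classical_set_scope.
Local Open Scope ring_scope.

(* Shrinking the policy towards wbar moves it by O(delta) and puts its values
   wbar + N y(x) in the relative interior of S, where psi is differentiable.
   There z(x) = - B^+ grad psi (y(x)) makes the shrunk point the exact minimizer
   of <F z, w> + phi(w), because dom phi lies in aff S, and z is continuous, because
   the gradient of a differentiable convex function is continuous. Strong convexity
   makes the solution map Lipschitz in z, so approximating z by G suffices. *)

(** * Euclidean inner product, compared with the max-norm *)

Section dot_product.
Context {R : realType} {n : nat}.
Implicit Types (u v w : 'cV[R]_n).

Lemma dotcvE u v : dotcv u v = (u^T *m v) 0 0.
Proof. by rewrite mxE; apply: eq_bigr => i _; rewrite mxE. Qed.

Lemma dotcvC u v : dotcv u v = dotcv v u.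
Proof. by apply: eq_bigr => i _; rewrite mulrC. Qed.

Lemma dotcvDr u v w : dotcv u (v + w) = dotcv u v + dotcv u w.
Proof. by rewrite !dotcvE mulmxDr mxE. Qed.

Lemma dotcvZr a u v : dotcv u (a *: v) = a * dotcv u v.
Proof. by rewrite !dotcvE -scalemxAr mxE. Qed.

Lemma dotcvNr u v : dotcv u (- v) = - dotcv u v.
Proof. by rewrite -scaleN1r dotcvZr mulN1r. Qed.

Lemma dotcvBr u v w : dotcv u (v - w) = dotcv u v - dotcv u w.
Proof. by rewrite dotcvDr dotcvNr. Qed.

Lemma dotcvDl u v w : dotcv (v + w) u = dotcv v u + dotcv w u.
Proof. by rewrite dotcvC dotcvDr !(dotcvC u). Qed.

Lemma dotcvZl a u v : dotcv (a *: v) u = a * dotcv v u.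
Proof. by rewrite dotcvC dotcvZr dotcvC. Qed.

Lemma dotcvNl u v : dotcv (- v) u = - dotcv v u.
Proof. by rewrite dotcvC dotcvNr dotcvC. Qed.

Lemma dotcvBl u v w : dotcv (v - w) u = dotcv v u - dotcv w u.
Proof. by rewrite dotcvDl dotcvNl. Qed.

Definition dotcv_linE :=
  (dotcvDr, dotcvDl, dotcvNr, dotcvNl, dotcvZr, dotcvZl).

Lemma dotcv_ge0 v : 0 <= dotcv v v.
Proof. by apply: sumr_ge0 => i _; rewrite -expr2 sqr_ge0. Qed.

Lemma sqr_l2norm v : l2norm v ^+ 2 = dotcv v v.
Proof. by rewrite sqr_sqrtr // dotcv_ge0. Qed.

Lemma l2norm_le v c : 0 <= c -> dotcv v v <= c ^+ 2 -> l2norm v <= c.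
Proof. by move=> c0 vc; rewrite -(ger0_norm c0) -sqrtr_sqr ler_wsqrtr. Qed.

Lemma dotcv_le_l2norm v c : l2norm v <= c -> dotcv v v <= c ^+ 2.
Proof.
move=> vc; rewrite -sqr_l2norm lerXn2r // nnegrE ?sqrtr_ge0 //.
by apply: le_trans vc; rewrite sqrtr_ge0.
Qed.

Lemma entry_le_l2norm v i : `|v i 0| <= l2norm v.
Proof.
rewrite -sqrtr_sqr ler_wsqrtr // /dotcv (bigD1 i) //= -expr2 lerDl.
by apply: sumr_ge0 => j _; rewrite -expr2 sqr_ge0.
Qed.

Lemma mx_norm_lt_l2norm v c : 0 < c -> dotcv v v < c ^+ 2 -> `|v| < c.
Proof.
move=> c0 vc; rewrite /Num.Def.normr /= mx_normrE; apply/bigmax_ltP.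
split=> // -[i j] _ /=; rewrite ord1; apply: le_lt_trans (entry_le_l2norm v i) _.
by rewrite -(ger0_norm (ltW c0)) -sqrtr_sqr ltr_sqrt // exprn_gt0.
Qed.

Lemma entry_le_mx_norm v i : `|v i 0| <= `|v|.
Proof.
rewrite [leRHS]/Num.Def.normr /= mx_normrE.
by apply/bigmax_geP; right; exists (i, 0).
Qed.

Lemma dotcv_le_mx_norm v : dotcv v v <= n%:R * `|v| ^+ 2.
Proof.
rewrite -{2}(card_ord n) -sum1_card natr_sum mulr_suml.
apply: ler_sum => i _; rewrite mul1r -expr2 -real_normK ?num_real //.
by rewrite lerXn2r ?nnegrE // entry_le_mx_norm.
Qed.

(** The parallelogram law. The triangle inequality is used in this squared form: two squared
    distances at most [(eps / 2) ^+ 2] give exactly [eps ^+ 2]. *)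
Lemma dotcvD_le u v :
  dotcv (u + v) (u + v) <= 2 * (dotcv u u + dotcv v v).
Proof.
have := dotcv_ge0 (u - v); rewrite !dotcv_linE (dotcvC v u).
lra.
Qed.

(** Expand the squared length of [u + k *: v]. This takes the place of Cauchy-Schwarz in the
    Lipschitz estimate for minimizers. *)
Lemma dotcv_young u v k :
  - (2 * k) * dotcv u v <= dotcv u u + k ^+ 2 * dotcv v v.
Proof.
by have := dotcv_ge0 (u + k *: v); rewrite !dotcv_linE (dotcvC v u); lra.
Qed.

End dot_product.

Lemma dotcv_mulmxl (R : realType) m n (M : 'M[R]_(m, n)) u v :
  dotcv (M *m u) v = dotcv u (M^T *m v).
Proof. by rewrite !dotcvE trmx_mul mulmxA. Qed.

Lemma dotcv_mulmx_le (R : realType) m n (M : 'M[R]_(m, n)) :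
  exists2 K, 0 <= K & forall v, dotcv (M *m v) (M *m v) <= K * dotcv v v.
Proof.
(* Each entry of [M *m v] is at most the l1 norm of that row times [l2norm v]; sum the squares. *)
exists (\sum_i (\sum_j `|M i j|) ^+ 2).
  by apply: sumr_ge0 => i _; rewrite sqr_ge0.
move=> v; rewrite mulr_suml; apply: ler_sum => i _.
rewrite -expr2 -real_normK ?num_real // -sqr_l2norm -exprMn.
rewrite lerXn2r ?nnegrE ?mulr_ge0 ?sqrtr_ge0 //; first exact: sumr_ge0.
rewrite mxE mulr_suml; apply: le_trans (ler_norm_sum _ _ _) _.
by apply: ler_sum => j _; rewrite normrM ler_wpM2l // entry_le_l2norm.
Qed.

(** * Entrywise convergence and continuity of affine maps *)

Section matrix_cvg.
Context {R : realType}.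

Lemma cvg_coord m n (T : Type) (F : set_system T) {FF : Filter F}
    (f : T -> 'M[R]_(m, n)) (l : 'M[R]_(m, n)) :
  (forall i j, f x i j @[x --> F] --> l i j) -> f x @[x --> F] --> l.
Proof.
move=> fl A [P Pl PA].
have : \forall x \near F, forall i j, P i j (f x i j).
  by apply: filter_forall => i; apply: filter_forall => j; exact: fl (Pl i j).
by apply: filterS => x Px; exact: PA.
Qed.

Lemma mulmx_continuous m n p (M : 'M[R]_(m, n)) :
  continuous (fun v : 'M[R]_(n, p) => M *m v).
Proof.
move=> v; apply: (cvg_coord (F := nbhs v)) => i j; rewrite [X in _ --> X]mxE.
under eq_fun do rewrite mxE.
apply: (cvg_big (op := +%R) (x0 := 0)) => [|k _]; first exact: add_continuous.
by apply: cvgMr; exact: coord_continuous.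
Qed.

Lemma dotcv_continuous n (u : 'cV[R]_n) : continuous (dotcv u).
Proof.
move=> v; have -> : dotcv u = (fun M : 'M[R]_1 => M 0 0) \o mulmx u^T.
  by apply/funext => w /=; rewrite dotcvE.
by apply: continuous_comp; [exact: mulmx_continuous|exact: coord_continuous].
Qed.

End matrix_cvg.

Lemma line_continuous (R : realType) (V : normedModType R) (x d : V) :
  continuous (fun t : R => x + t *: d).
Proof.
move=> t; apply: cvgD; first exact: cvg_cst.
by apply: cvgZ; [exact: cvg_id|exact: cvg_cst].
Qed.

Lemma homothety_continuous (R : realType) (V : normedModType R) (x y : V) c :
  continuous (fun v => x + c *: (v - y)).
Proof.
move=> v; apply: cvgD; first exact: cvg_cst.
apply: cvgZ; first exact: cvg_cst.
by apply: cvgB; [exact: cvg_id|exact: cvg_cst].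
Qed.

Lemma translation_continuous (R : realType) (V : normedModType R) (d : V) :
  continuous (fun v => v + d).
Proof. by move=> v; apply: cvgD; [exact: cvg_id|exact: cvg_cst]. Qed.

Lemma contraction_continuous (R : realType) (V : normedModType R) (y : V) c :
  continuous (fun v => v + c *: (y - v)).
Proof.
move=> v; apply: cvgD; first exact: cvg_id.
apply: cvgZ; first exact: cvg_cst.
by apply: cvgB; [exact: cvg_cst|exact: cvg_id].
Qed.

(** * Affine hulls and relative interiors *)

Section relative_interior.
Context {R : realType} {n : nat}.
Implicit Types (A S D : set 'cV[R]_n).

Lemma affine_hull_line A x y t : A x -> A y -> affine_hull A (x + t *: (y - x)).
Proof.
move=> Ax Ay.
exists 2%N, (fun i => if i == 0 then x else y),
  (fun i => if i == 0 then 1 - t else t).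
split=> [i||]; first by case: ifP.
  by rewrite big_ord_recl big_ord1 /= subrK.
by rewrite big_ord_recl big_ord1 /= scalerBl scalerBr scale1r addrA addrAC.
Qed.

Lemma sub_affine_hull A : A `<=` affine_hull A.
Proof.
by move=> x Ax; have := affine_hull_line 0 Ax Ax; rewrite scale0r addr0.
Qed.

(** The relative interior is relatively open: a neighbourhood of [w] is a neighbourhood of every
    point close to [w]. *)
Lemma near_relint A w : relint A w ->
  \forall v \near w, affine_hull A v -> relint A v.
Proof.
move=> [_ /near_join]; apply: filterS => v Av hv; split => //.
exact: nbhs_singleton Av hv.
Qed.

(** The line through [w] and [v] stays in the affine hull and is continuous at parameter 0, so small
    positive parameters remain in the relative interior. *)
Lemma relint_line A w v : relint A w -> A v ->
  exists2 t : R, 0 < t & relint A (w + t *: (v - w)).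
Proof.
move=> Aw Av.
have c0 : (w + t *: (v - w)) @[t --> 0] --> w.
  by have := @line_continuous _ _ w (v - w) 0; rewrite /continuous_at scale0r addr0.
have /nbhs_ballP[e /= e0 he] := c0 _ (near_relint Aw).
exists (e / 2); first by rewrite divr_gt0.
apply: he; last by apply: affine_hull_line => //; case: Aw.
by rewrite /ball /= sub0r normrN gtr0_norm ?divr_gt0 // ltr_pdivrMr //; lra.
Qed.

(* Moving from w slightly towards a point of D stays in the relative interior of D,
   hence in S; two points of a line in an affine set force the whole line. *)
Lemma eq_relint_sub p (M : 'M[R]_(p, n)) b S D w :
  affine_hull S = [set v | M *m v = b] -> relint S = relint D ->
  relint S w -> D `<=` affine_hull S.
Proof.
move=> haff SD Sw v Dv; have Dw := Sw; rewrite SD in Dw.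
have [t t0] := relint_line Dw Dv.
rewrite -SD => -[/sub_affine_hull + _]; case: Sw => /sub_affine_hull + _.
rewrite haff /= => Mw; rewrite mulmxDr -scalemxAr mulmxBr Mw => /eqP.
rewrite -subr_eq0 [_ + _ - _]addrC addKr scaler_eq0 gt_eqF //= subr_eq0.
by move/eqP.
Qed.

Lemma convex_setP S x y t : convex_set S -> S x -> S y -> 0 <= t <= 1 ->
  S (x + t *: (y - x)).
Proof.
move=> cS Sx Sy t01.
have := cS y x (Itv01 (andP t01).1 (andP t01).2).
rewrite !inE => /(_ Sy Sx); rewrite /conv /= /unstable.onem.
by rewrite scalerBl scalerBr scale1r addrCA.
Qed.

(* The homothety of centre x that sends the segment point back to w carries a
   neighbourhood witnessing [relint S w] to one of the segment point. *)
Lemma relint_segment p (M : 'M[R]_(p, n)) b S w x t :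
  affine_hull S = [set v | M *m v = b] -> convex_set S ->
  relint S w -> S x -> 0 < t <= 1 -> relint S (x + t *: (w - x)).
Proof.
move=> haff cS [Sw nw] Sx /andP[t0 t1].
have t01 : 0 <= t <= 1 by rewrite (ltW t0).
split; first exact: convex_setP.
pose g v := x + t^-1 *: (v - x).
have gK v : x + t *: (g v - x) = v.
  by rewrite /g [x + _ - x]addrC addKr scalerA divff ?gt_eqF // scale1r addrC subrK.
have cg : continuous g by exact: homothety_continuous.
have gw : g (x + t *: (w - x)) = w.
  rewrite /g [x + _ - x]addrC addKr scalerA mulVf ?gt_eqF // scale1r.
  by rewrite addrC subrK.
have : \forall v \near x + t *: (w - x), affine_hull S (g v) -> S (g v).
  by have := cg (x + t *: (w - x)); rewrite /continuous_at gw => /(_ _ nw).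
apply: filterS => v /= Sg hv.
rewrite -(gK v); apply: convex_setP => //; apply: Sg.
have := sub_affine_hull Sx; move: hv; rewrite haff /= => hv hx.
by rewrite mulmxDr -scalemxAr mulmxBr hv hx subrr scaler0 addr0.
Qed.

End relative_interior.

(** * Existence and stability of minimizers of strongly convex functions *)

Section strongly_convex_minimization.
Context {R : realType} {n : nat}.
Implicit Types (f : 'cV[R]_n -> \bar R) (u v w x y : 'cV[R]_n).

(** Real upper bounds [a] and [b] stand for the values of [f], so the right-hand side is real and
    points of value [+oo] impose nothing. *)
Definition midpoint_strongly_convex (c : R) f := forall x y (a b : R),
  (f x <= a%:E)%E -> (f y <= b%:E)%E ->
  (f (2^-1 *: (x + y))%R <= ((a + b) / 2 - c * dotcv (x - y) (x - y))%:E)%E.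

Lemma midpoint_strongly_convexD c f u : midpoint_strongly_convex c f ->
  midpoint_strongly_convex c (fun w => ((dotcv u w)%:E + f w)%E).
Proof.
move=> fc x y a b; rewrite addeC -leeBrDr // -EFinB => fx.
rewrite addeC -leeBrDr // -EFinB => fy.
rewrite addeC -leeBrDr // -EFinB; apply: le_trans (fc _ _ _ _ fx fy) _.
by rewrite lee_fin !dotcv_linE; lra.
Qed.

(** Quadratic growth: the value at the midpoint of [x] and [y] cannot fall below the minimum [a]. *)
Lemma argmin_growth c f x y (a b : R) : midpoint_strongly_convex c f ->
  argmin f x -> f x = a%:E -> (f y <= b%:E)%E ->
  a + 2 * c * dotcv (x - y) (x - y) <= b.
Proof.
move=> fc fx fxa fy; have := le_trans (fx _) (fc x y a b _ fy).
by rewrite fxa lexx lee_fin => /(_ isT); lra.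
Qed.

(** Adding the growth inequalities of the two problems cancels the values of [f] and leaves [4 * c *
    |w1 - w2|^2 <= - <u1 - u2, w1 - w2>]; [dotcv_young] with factor [4 * c] then removes the inner
    product. *)
Lemma argmin_lipschitz c f u1 u2 w1 w2 : 0 < c ->
  midpoint_strongly_convex c f -> eproper f ->
  argmin (fun w => ((dotcv u1 w)%:E + f w)%E) w1 ->
  argmin (fun w => ((dotcv u2 w)%:E + f w)%E) w2 ->
  dotcv (w1 - w2) (w1 - w2) <= dotcv (u1 - u2) (u1 - u2) / (4 * c) ^+ 2.
Proof.
move=> c0 fc [fNy [w0 fw0]] m1 m2.
(* Comparison with a point [w0] of the domain shows that [f] is finite at any minimizer. *)
have fin u w : argmin (fun w => ((dotcv u w)%:E + f w)%E) w ->
    exists a, f w = a%:E.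
  move=> /(_ w0); move: (fNy w) (fNy w0) fw0; rewrite /edom /=.
  by case: (f w) => [a| |] //; [exists a|case: (f w0)].
have [[a1 e1] [a2 e2]] := (fin _ _ m1, fin _ _ m2).
have := argmin_growth (y := w2) (a := dotcv u1 w1 + a1) (b := dotcv u1 w2 + a2)
  (midpoint_strongly_convexD (u := u1) fc) m1.
have := argmin_growth (y := w1) (a := dotcv u2 w2 + a2) (b := dotcv u2 w1 + a1)
  (midpoint_strongly_convexD (u := u2) fc) m2.
rewrite e1 e2 -!EFinD => /(_ erefl (lexx _)) h2 /(_ erefl (lexx _)) h1.
rewrite ler_pdivlMr; last by rewrite exprn_gt0 ?mulr_gt0.
have := dotcv_young (u1 - u2) (w1 - w2) (4 * c).
have e : dotcv (w2 - w1) (w2 - w1) = dotcv (w1 - w2) (w1 - w2).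
  by rewrite -opprB dotcvNl dotcvNr opprK.
move: h1 h2; rewrite e {e}; set d := dotcv (w1 - w2) _ => h1 h2.
have : 4 * c * d <= - dotcv (u1 - u2) (w1 - w2).
  by rewrite dotcvBl !dotcvBr; move: h1 h2; lra.
set s := dotcv _ (w1 - w2) => ds; rewrite expr2.
have : 4 * c * (4 * c * d) <= 4 * c * - s by rewrite ler_pM2l // mulr_gt0.
by lra.
Qed.

(* Finiteness of the infimum and midpoint convexity make minimizing sequences
   Cauchy, so no coercivity argument is needed. *)
Lemma argmin_exists c f (m : R) : 0 < c -> midpoint_strongly_convex c f ->
  lower_semicontinuous f -> (forall w, (m%:E <= f w)%E) -> edom f !=set0 ->
  argmin f !=set0.
Proof.
move=> c0 fc flsc fm [w0 fw0].
have infle w : (ereal_inf (range f) <= f w)%E by apply: ereal_inf_lbound; exists w.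
have : ereal_inf (range f) \is a fin_num.
  rewrite fin_real // (le_lt_trans (infle w0) fw0) andbT.
  apply: (@lt_le_trans _ _ m%:E); first exact: ltNyr.
  by apply/ereal_infP => _ [w _ <-].
move=> /[dup] fin /fineK; set i := fine _ => ie.
have /choice[w wE] (k : nat) : exists w, (f w < (i + k.+1%:R^-1)%:E)%E.
  have [|_ [w _ <-]] := @lb_ereal_inf_adherent _ (range f) (k.+1%:R^-1) _ fin.
    by rewrite invr_gt0.
  by rewrite -ie; exists w.
(* The value at the midpoint of [w j] and [w k] is at least the infimum [i], so their squared
   distance is controlled by the mean of the two gaps. *)
have dist j k : c * dotcv (w j - w k) (w j - w k)
    <= (j.+1%:R^-1 + k.+1%:R^-1) / 2.
  have := fc _ _ _ _ (ltW (wE j)) (ltW (wE k)).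
  move=> /(le_trans (infle _)); rewrite -ie lee_fin.
  move: (j.+1%:R^-1) (k.+1%:R^-1) => p q; lra.
have : cauchy (w @ \oo).
  apply: cauchy_exP => e e0.
  have ce : 0 < c * e ^+ 2 by rewrite mulr_gt0 // exprn_gt0.
  have [N _ hN] := near_infty_natSinv_lt (PosNum ce).
  have {}hN j : (N <= j)%N -> j.+1%:R^-1 < c * e ^+ 2 by exact: hN.
  exists (w N); exists N => // k /= Nk.
  rewrite -ball_normE /= mx_norm_lt_l2norm // -(ltr_pM2l c0).
  apply: le_lt_trans (dist _ _) _.
  move: (hN _ Nk) (hN _ (leqnn N)).
  by move: (N.+1%:R^-1) (k.+1%:R^-1) => p q; lra.
move/cauchy_cvg/cvg_ex => [l wl].
exists l => v; apply: le_trans (infle v); rewrite -ie.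
(* If [f l] exceeded [i + e], lower semicontinuity would keep [f (w k)] above [i + e] for large [k],
   against the choice of [w]. *)
apply/lee_addgt0Pr => e e0; rewrite leNgt; apply/negP.
move=> /flsc[V /wl[N1 _ h1] hV].
have [N2 _ h2] := near_infty_natSinv_lt (PosNum e0).
have := h1 (maxn N1 N2) (leq_maxl _ _) => /= /hV; apply/negP.
rewrite -leNgt; apply: le_trans (ltW (wE _)) _.
by rewrite lee_fin lerD2l ltW //; apply: (h2 (maxn N1 N2) (leq_maxr _ _)).
Qed.

End strongly_convex_minimization.

Lemma lower_semicontinuous_addl (R : realType) (T : topologicalType)
    (g : T -> R) (f : T -> \bar R) :
  continuous g -> lower_semicontinuous f ->
  lower_semicontinuous (fun x => ((g x)%:E + f x)%E).
Proof.
move=> gc flsc x a.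
rewrite addeC -lteBlDr // -EFinB => afx.
(* The real [r] splits the strict inequality: near [x], [f] stays above [r] and [g] above
   [a - r]. *)
have [r ar rf] : exists2 r, a - g x < r & (r%:E < f x)%E.
  move: afx; case: (f x) => [s| |] // h.
    by exists ((a - g x + s) / 2); move: h; rewrite !lte_fin; lra.
  by exists (a - g x + 1); [lra|rewrite ltry].
have [V xV hV] := flsc _ _ rf.
have gnear : \forall y \near x, a - r < g y.
  by apply: (cvgr_gt (g x)); [exact: gc|lra].
exists (V `&` [set y | a - r < g y]); first exact: filterI.
move=> y [/hV ry /= gy]; rewrite addeC -lteBlDr // -EFinB.
by apply: lt_trans ry; rewrite lte_fin; lra.
Qed.

(** * Subgradient inequality and continuity of the gradient of a convex function *)

Section convex_gradient.
Context {R : realType} {n : nat}.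
Implicit Types (f : 'cV[R]_n -> \bar R) (x y d v : 'cV[R]_n).

Lemma diff_dotcv_gradient (g : 'cV[R]_n -> R) x d : differentiable g x ->
  'd g x d = dotcv (gradient g x) d.
Proof.
move=> gx; rewrite [in LHS](matrix_sum_delta d) linear_sum /dotcv.
apply: eq_bigr => i _; rewrite big_ord1 linearZZ [gradient _ _ _ _]mxE.
by rewrite (ord1 ord0); exact: mulrC.
Qed.

Lemma dirderiv_cvg_right (g : 'cV[R]_n -> R) x d : differentiable g x ->
  t^-1 * (g (x + t *: d) - g x) @[t --> 0^'+] --> dotcv (gradient g x) d.
Proof.
move=> gx; rewrite -diff_dotcv_gradient // -deriveE //.
have /cvg_dnbhs_at_right := diff_derivable (v := d) gx.
apply: cvg_trans; apply: near_eq_cvg; near=> t.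
by rewrite /= [x + _]addrC.
Unshelve. all: by end_near. Qed.

(** By convexity every forward difference quotient from [y] towards [v], with step at most 1, is at
    most [f v - f y]; let the step tend to 0. *)
Lemma econvex_subgradient f y v : (forall w, f w != -oo%E) -> econvex f ->
  edifferentiable f y ->
  (f y + (dotcv (egradient f y) (v - y))%:E <= f v)%E.
Proof.
move=> fNy fc [/nbhs_singleton fy df].
rewrite -(fineK fy); move: (fNy v) (fc v y); case: (f v) => [b| |] // _ fcv.
  2: by rewrite leey.
rewrite -EFinD lee_fin -lerBrDl.
have := dirderiv_cvg_right (d := v - y) df; rewrite -/(egradient f y) => cv.
rewrite -(cvg_lim _ cv) //; apply: limr_le; first by apply/cvg_ex; eexists; exact: cv.
near=> t.
have t0 : 0 < t by near: t; exact: nbhs_right_gt.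
have t01 : 0 <= t <= 1.
  rewrite (ltW t0) /=; near: t; exact: nbhs_right_le.
have := fcv _ t01; rewrite -{1}(fineK fy).
have -> : t *: v + (1 - t) *: y = y + t *: (v - y).
  by rewrite scalerBl scalerBr scale1r addrCA.
rewrite -!EFinM -EFinD ler_pdivrMl //=.
move: (fNy (y + t *: (v - y))); case: (f _) => [a| |] // _.
by rewrite lee_fin /=; lra.
Unshelve. all: by end_near. Qed.

(* By the subgradient inequality, the directional derivative at v is at most any
   forward difference quotient at v, and those are continuous in v. *)
Lemma egradient_near_lt f (Y : set 'cV[R]_n) y d (e : R) :
  (forall w, f w != -oo%E) -> econvex f -> open Y ->
  (forall y, Y y -> edifferentiable f y) -> Y y -> 0 < e ->
  \forall v \near y,
    dotcv (egradient f v) d < dotcv (egradient f y) d + e.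
Proof.
move=> fNy fc oY dfY Yy e0.
pose F := fine \o f.
have dF : differentiable F y by case: (dfY y Yy).
pose G := dotcv (egradient f y) d.
have cont_line v : (v + s *: d) @[s --> 0^'+] --> v.
  apply: cvg_at_right_filter.
  by have := @line_continuous _ _ v d 0; rewrite /continuous_at scale0r addr0.
(* The step [s] is fixed once, at [y]; from here on only the base point [v] of the quotient
   varies. *)
have [s [s0 Ys qs]] : exists s : R, [/\ 0 < s, Y (y + s *: d)
    & s^-1 * (F (y + s *: d) - F y) < G + e].
  have /filter_ex [s [[? ?] ?]] : \forall s \near 0^'+, (0 < s /\ Y (y + s *: d))
      /\ s^-1 * (F (y + s *: d) - F y) < G + e.
    apply: filterI; first apply: filterI.
    - exact: nbhs_right_gt.
    - by apply: (cont_line y); exact: open_nbhs_nbhs.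
    - by apply: (cvgr_lt _ (dirderiv_cvg_right (d := d) dF)); rewrite ltrDl.
  by exists s.
have cs : (v + s *: d) @[v --> y] --> y + s *: d.
  exact: translation_continuous.
have Fs : F (v + s *: d) @[v --> y] --> F (y + s *: d).
  apply: (cvg_comp _ _ cs).
  by apply: differentiable_continuous; case: (dfY _ Ys).
have q_near : \forall v \near y, s^-1 * (F (v + s *: d) - F v) < G + e.
  have qv : s^-1 * (F (v + s *: d) - F v) @[v --> y]
      --> s^-1 * (F (y + s *: d) - F y).
    exact: (cvgM (cvg_cst _) (cvgB Fs (differentiable_continuous dF))).
  exact: (cvgr_lt _ qv _ qs).
have Y_near : \forall v \near y, Y v by exact: open_nbhs_nbhs.
have fin_near : \forall v \near y, f (v + s *: d) \is a fin_num.
  by have [/cs] := dfY _ Ys.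
near=> v.
have Yv : Y v by near: v.
have fvs : f (v + s *: d) \is a fin_num by near: v.
apply: le_lt_trans (_ : _ <= s^-1 * (F (v + s *: d) - F v)) _; last by near: v.
have := econvex_subgradient (v + s *: d) fNy fc (dfY _ Yv).
rewrite (addrC v) addrK -(addrC v) dotcvZr -(fineK fvs) /F /=.
rewrite -(fineK (nbhs_singleton (dfY _ Yv).1)) -EFinD lee_fin ler_pdivlMl //=.
by lra.
Unshelve. all: by end_near. Qed.

(** The one-sided bound of [egradient_near_lt], applied to a basis vector and to its opposite,
    bounds each entry from both sides. *)
Lemma egradient_continuous f (Y : set 'cV[R]_n) y :
  (forall w, f w != -oo%E) -> econvex f -> open Y ->
  (forall y, Y y -> edifferentiable f y) -> Y y ->
  {for y, continuous (egradient f)}.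
Proof.
move=> fNy fc oY dfY Yy; apply: (cvg_coord (F := nbhs y)) => i j.
rewrite ord1 {j}; apply/cvgrPdist_lt => e e0.
have [d entryE] : exists d : 'cV[R]_n, forall v : 'cV[R]_n, v i 0 = dotcv v d.
  exists (delta_mx i 0) => v; rewrite /dotcv (bigD1 i) //= mxE !eqxx mulr1.
  rewrite big1 ?addr0 // => k ki.
  by rewrite mxE (negbTE ki) mulr0.
have lt1 := egradient_near_lt d fNy fc oY dfY Yy e0.
have lt2 := egradient_near_lt (- d) fNy fc oY dfY Yy e0.
suff : \forall v \near y, `|egradient f y i 0 - egradient f v i 0| < e by [].
apply: filterS2 lt1 lt2 => v.
move: (egradient f v) (egradient f y) => a c.
rewrite !dotcvNr -!entryE ltr_norml.
by move=> h1 h2; apply/andP; split; lra.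
Qed.

End convex_gradient.

(** * Passage between [phi] and the reduced function *)

Section reduction.
Context {R : realType} {n r : nat} (N : 'M[R]_(n, r)) (wbar : 'cV[R]_n).
Implicit Types (phi : 'cV[R]_n -> \bar R) (S : set 'cV[R]_n).
Hypothesis NN : N^T *m N = 1%:M.

Lemma dotcv_isometry (u v : 'cV[R]_r) : dotcv (N *m u) (N *m v) = dotcv u v.
Proof. by rewrite dotcv_mulmxl mulmxA NN mul1mx. Qed.

(** At [t = 1/2] the modulus [mu / 2 * t * (1 - t)] is [mu / 8]. The domain of [phi] lies in [wbar]
    plus the range of the isometry [N], so the estimate carries over from the reduced function with
    the same distances. *)
Lemma reduced_fun_midpoint phi mu :
  (forall w, edom phi w -> exists y, w = wbar + N *m y) ->
  strongly_convex mu (reduced_fun wbar N phi) ->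
  midpoint_strongly_convex (mu / 8) phi.
Proof.
move=> domN sc x y a b xa yb.
have [u xu] := domN x (le_lt_trans xa (ltry _)).
have [v yv] := domN y (le_lt_trans yb (ltry _)).
have h01 : 0 <= (2^-1 : R) <= 1 by rewrite invr_ge0 ler0n invf_le1 ?ler1n.
have := sc u v _ h01; rewrite /reduced_fun -xu -yv.
have -> : wbar + N *m (2^-1 *: u + (1 - 2^-1) *: v) = 2^-1 *: (x + y).
  rewrite (_ : 1 - 2^-1 = 2^-1 :> R); last by lra.
  rewrite xu yv mulmxDr -!scalemxAr !scalerDr addrACA -scalerDl.
  by rewrite (_ : 2^-1 + 2^-1 = 1 :> R) ?scale1r //; lra.
have -> : l2norm (u - v) ^+ 2 = dotcv (x - y) (x - y).
  rewrite sqr_l2norm -dotcv_isometry mulmxBr xu yv.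
  by rewrite opprD addrACA subrr add0r.
move=> /le_trans; apply.
have -> : (((a + b) / 2 - mu / 8 * dotcv (x - y) (x - y))%:E =
    (2^-1)%:E * a%:E + (1 - 2^-1)%:E * b%:E -
    (mu / 2 * 2^-1 * (1 - 2^-1) * dotcv (x - y) (x - y))%:E)%E.
  by rewrite -!EFinM -!EFinD; congr (_%:E); lra.
apply: leeB => //; apply: leeD; apply: lee_wpmul2l => //; rewrite lee_fin; lra.
Qed.

Lemma reduced_fun_econvex phi : econvex phi -> econvex (reduced_fun wbar N phi).
Proof.
move=> c x y t t01; have := c (wbar + N *m x) (wbar + N *m y) t t01.
rewrite /reduced_fun; congr (phi _ <= _)%E.
rewrite mulmxDr -!scalemxAr !scalerDr addrACA -scalerDl.
by rewrite [t + _]addrC subrK scale1r.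
Qed.

(** Every [wbar + N *m y] lies in the affine hull, so relative openness pulls back to openness. *)
Lemma open_reduced_set S :
  (forall y, affine_hull S (wbar + N *m y)) -> open (reduced_set wbar N S).
Proof.
move=> hS; rewrite openE => y /near_relint rS.
have c : continuous (fun y => wbar + N *m y).
  have -> : (fun y => wbar + N *m y) = (fun v => v + wbar) \o mulmx N.
    by apply/funext => z; rewrite /= addrC.
  move=> z; apply: continuous_comp; first exact: mulmx_continuous.
  exact: translation_continuous.
have : \forall v \near y,
    affine_hull S (wbar + N *m v) -> relint S (wbar + N *m v).
  exact: (c y _ rS).
by apply: filterS => v; apply.
Qed.

Section minimizers.
Variables (k : nat) (F : 'M[R]_(n, k)) (phi : 'cV[R]_n -> \bar R) (mu : R).
Hypotheses (mu0 : 0 < mu) (phiP : eproper phi)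
  (domN : forall w, edom phi w -> exists y, w = wbar + N *m y)
  (sc : strongly_convex mu (reduced_fun wbar N phi)).

Let f z w := ((dotcv (F *m z) w)%:E + phi w)%E.

(** By Fenchel-Young, a finite conjugate at [- (N^T *m F *m z)] bounds the objective below, which is
    what [argmin_exists] asks for. A minimizer then exists, so [xget] does not return its
    default. *)
Lemma solution_map_argmin z : lower_semicontinuous phi ->
  econjugate (reduced_fun wbar N phi) (- (N^T *m F *m z)) \is a fin_num ->
  argmin (f z) (solution_map F phi z).
Proof.
move=> lsc cfin; suff wm : argmin (f z) !=set0 by exact: xgetPex wm.
set s := fine (econjugate (reduced_fun wbar N phi) (- (N^T *m F *m z))).
have c0 : 0 < mu / 8 by rewrite divr_gt0.
apply: (argmin_exists (m := dotcv (F *m z) wbar - s) c0).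
- exact: midpoint_strongly_convexD (reduced_fun_midpoint domN sc).
- by apply: lower_semicontinuous_addl lsc; exact: dotcv_continuous.
- move=> w; rewrite /f; case: phiP => /(_ w) + _.
  case E : (phi w) => [a| |] // _; last by rewrite leey.
  have [|y wy] := domN (w := w); first by rewrite /edom /= E ltry.
  have : (((dotcv (- (N^T *m F *m z)) y)%:E - a%:E)%E <= s%:E)%E.
    rewrite /s fineK // -E wy; apply: ereal_sup_ubound.
    by exists y.
  rewrite -EFinD !lee_fin wy dotcvDr (dotcvC _ (N *m y)) (dotcv_mulmxl N).
  by rewrite mulmxA dotcvNl (dotcvC y); lra.
- case: phiP => fNy [w fw]; exists w; rewrite /edom /f /=.
  by apply: lte_add_pinfty => //; exact: ltry.
Qed.

(** The equation on [z] is the first-order optimality condition in the coordinates [y]; the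
    subgradient inequality makes it sufficient for a global minimum. *)
Lemma argmin_subgradient z y : econvex phi ->
  edifferentiable (reduced_fun wbar N phi) y ->
  N^T *m F *m z = - egradient (reduced_fun wbar N phi) y ->
  argmin (f z) (wbar + N *m y).
Proof.
move=> c dy zy w; have [fNy _] := phiP.
case E : (phi w) => [a| |].
- have [|v wv] := domN (w := w); first by rewrite /edom /= E ltry.
  have fzE u : dotcv (F *m z) (wbar + N *m u) = dotcv (F *m z) wbar
      - dotcv (egradient (reduced_fun wbar N phi) y) u.
    rewrite dotcvDr (dotcvC _ (N *m u)) (dotcv_mulmxl N) mulmxA zy.
    by rewrite dotcvNr (dotcvC u).
  have := econvex_subgradient v (fun w => fNy _) (reduced_fun_econvex c) dy.
  have := fineK (nbhs_singleton dy.1); set g := egradient _ y in fzE *.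
  rewrite /f E /reduced_fun => <-; rewrite wv in E *; rewrite E !fzE.
  by rewrite -!EFinD !lee_fin dotcvBr; lra.
- by rewrite /f E leey.
- by have := fNy w; rewrite E.
Qed.

End minimizers.
End reduction.

(** * Continuous maps on a compact set and the approximation theorem *)

Lemma within_continuous_bounded (R : realType) (m n : nat) (X : set 'cV[R]_m)
    (f : 'cV[R]_m -> 'cV[R]_n) : compact X -> {within X, continuous f} ->
  exists2 Q, 0 <= Q & forall x, X x -> dotcv (f x) (f x) <= Q.
Proof.
move=> cX cf; have [M [_ hM]] := compact_bounded (continuous_compact cf cX).
(* [compact_bounded] gives a bound only for reals strictly above [M], hence the [+ 1]. *)
exists (n%:R * (`|M| + 1) ^+ 2); first by rewrite mulr_ge0 // sqr_ge0.
move=> x Xx; apply: le_trans (dotcv_le_mx_norm _) _.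
rewrite ler_wpM2l // lerXn2r ?nnegrE ?addr_ge0 //.
by apply: (hM (`|M| + 1)); [rewrite ltr_pwDr // ler_norm|exists x].
Qed.

(** Continuity of [g] is asked only at the points [f x], since the gradient is known to be
    continuous only on the reduced set. *)
Lemma within_continuous_comp (T U V : topologicalType) (X : set T)
    (f : T -> U) (g : U -> V) : {within X, continuous f} ->
  (forall x, X x -> {for f x, continuous g}) -> {within X, continuous (g \o f)}.
Proof.
move=> /subspace_continuousP cf cg; apply/subspace_continuousP => x Xx.
exact: cvg_comp (cf x Xx) (cg x Xx).
Qed.

Theorem proposition2 (R : realType) (n p r k k1 : nat)
    (hp : (p < n)%N) (hr : r = (n - p)%N) (hk : (r <= k)%N)
    (S : set 'cV[R]_n) (hS0 : S !=set0) (hScl : closed S) (hScv : convex_set S)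
    (A : 'M[R]_(p, n)) (b : 'cV[R]_p) (hA : \rank A = p)
    (haff : affine_hull S = [set w | A *m w = b])
    (N : 'M[R]_(n, r)) (hN : orthonormal_kernel_basis A N)
    (wbar : 'cV[R]_n) (hwbar : relint S wbar)
    (F : 'M[R]_(n, k)) (hF : \rank (N^T *m F) = r)
    (phi : 'cV[R]_n -> \bar R) (hphi : admissible_legendre S wbar N phi)
    (X : set 'cV[R]_k1) (hX : compact X)
    (G : set ('cV[R]_k1 -> 'cV[R]_k))
    (hG : forall h : 'cV[R]_k1 -> 'cV[R]_k, {within X, continuous h} ->
       forall eps : R, 0 < eps ->
       exists2 g, G g & (sup_dist X g h <= eps%:E)%E)
    (policy : 'cV[R]_k1 -> 'cV[R]_n) (hpolicy : {within X, continuous policy})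
    (hpolicyS : forall x, X x -> S (policy x)) :
  forall eps : R, 0 < eps ->
  exists2 pihat, policy_class F phi G pihat
    & (sup_dist X pihat policy <= eps%:E)%E.
Proof.
move=> eps eps0.
case: hphi => -[phiP philsc phic hrel] [mu mu0 sc] [dpsi _] conj.
case: hN => NN /seteqP[rN1 rN2].
pose psi := reduced_fun wbar N phi; pose B := N^T *m F.
have kerN (v : 'cV[R]_n) : A *m v = 0 -> exists y, v = N *m y by move=> /rN2[y _ <-]; exists y.
have AN (y : 'cV[R]_r) : A *m (N *m y) = 0 by apply: rN1; exists y.
have Sb w : affine_hull S w -> A *m w = b by rewrite haff.
have wbarb : A *m wbar = b by apply/Sb/sub_affine_hull; case: hwbar.
have domN w : edom phi w -> exists y, w = wbar + N *m y.
  move=> /(eq_relint_sub haff hrel hwbar)/Sb wb.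
  have [|y wy] := kerN (w - wbar); first by rewrite mulmxBr wb wbarb subrr.
  by exists y; rewrite -wy addrC subrK.
have oY : open (reduced_set wbar N S).
  by apply: open_reduced_set => y; rewrite haff /= mulmxDr AN addr0.
have [K K0 hK] := dotcv_mulmx_le F.
have cw : {within X, continuous (fun x => policy x - wbar)}.
  exact: (within_continuous_comp hpolicy
    (fun x _ => @translation_continuous _ _ (- wbar) (policy x))).
have [Q Q0 hQ] := within_continuous_bounded hX cw.
(* The summand [eps / 2] helps keep [delta] below 1; the denominator is at least 1 and at least [Q],
   so its square is at least [Q] and [delta ^+ 2 * Q <= (eps / 2) ^+ 2]. *)
pose delta := (eps / 2) / (Q + 1 + eps / 2).
have D0 : 0 < Q + 1 + eps / 2 by lra.
have delta01 : 0 < delta < 1.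
  by rewrite divr_gt0 ?ltr_pdivrMr //=; lra.
pose shrink w := w + delta *: (wbar - w).
(* On the kernel of [A], [N^T] inverts [N], so [red] gives the coordinates of the shrunk point. *)
pose red w := N^T *m (shrink w - wbar).
have redE x : X x -> shrink (policy x) = wbar + N *m red (policy x).
  move=> Xx; have [|y wy] := kerN (shrink (policy x) - wbar).
    have Ap : A *m policy x = b by apply/Sb/sub_affine_hull/hpolicyS.
    rewrite mulmxBr mulmxDr -scalemxAr mulmxBr Ap wbarb subrr scaler0.
    by rewrite addr0 subrr.
  by rewrite /red wy (mulmxA N^T) NN mul1mx -wy addrC subrK.
have Yred x : X x -> reduced_set wbar N S (red (policy x)).
  move=> Xx; rewrite /reduced_set /= -redE //.
  apply: (relint_segment (t := delta) haff hScv hwbar (hpolicyS x Xx)).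
  by case/andP: delta01 => -> /ltW.
(* [B] has full row rank, so [pinvmx B] is a right inverse and
   [B *m hpol w = - egradient psi (red w)], the optimality condition. *)
pose hpol w := - pinvmx B *m egradient psi (red w).
have ch : {within X, continuous (hpol \o policy)}.
  apply: within_continuous_comp hpolicy _ => x Xx.
  apply: continuous_comp; last exact: mulmx_continuous.
  apply: continuous_comp; last first.
    have psic : econvex psi by exact: reduced_fun_econvex.
    apply: (egradient_continuous _ psic oY dpsi) => //.
    - by move=> w; have [h _] := phiP; exact: h.
    - exact: Yred.
  apply: (@continuous_comp _ _ _ _ (mulmx N^T)); last exact: mulmx_continuous.
  apply: (@continuous_comp _ _ _ shrink (fun w => w - wbar)).
    exact: contraction_continuous.
  exact: translation_continuous.
(* The squared Lipschitz constant of the solution map is [K / (mu / 2) ^+ 2], and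
   [K <= (K + 1) ^+ 2] brings the error down to [eps / 2]. *)
pose eta := (eps / 2) * (mu / 2) / (K + 1).
have eta0 : 0 < eta by rewrite divr_gt0 ?mulr_gt0 ?divr_gt0 //; lra.
have [g Gg hg] := hG _ ch _ eta0.
exists (solution_map F phi \o g); first by exists g.
apply: ge_ereal_sup => _ [x Xx <-]; rewrite lee_fin.
apply: l2norm_le; first exact: ltW.
have opt z : argmin (fun w => ((dotcv (F *m z) w)%:E + phi w)%E)
    (solution_map F phi z).
  apply: (solution_map_argmin NN mu0 phiP domN sc philsc).
  (* Twice differentiability of the conjugate at a point includes its finiteness there. *)
  by have [/nbhs_singleton[/nbhs_singleton]] := conj (- (N^T *m F *m z)).
have opth : argmin (fun w => ((dotcv (F *m hpol (policy x)) w)%:E + phi w)%E)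
    (shrink (policy x)).
  rewrite redE //; apply: argmin_subgradient => //.
    by apply: dpsi; exact: Yred.
  rewrite -/B /hpol mulNmx mulmxN mulmxA mulmxVp ?mul1mx //.
  by rewrite /row_free hF.
have c0 : 0 < mu / 8 by rewrite divr_gt0.
have lip := argmin_lipschitz c0 (reduced_fun_midpoint NN domN sc) phiP
  (opt (g x)) opth.
have gh : dotcv (g x - hpol (policy x)) (g x - hpol (policy x)) <= eta ^+ 2.
  apply: dotcv_le_l2norm; rewrite -lee_fin; apply: le_trans hg.
  by apply: ereal_sup_ubound; exists x.
have part1 : dotcv (solution_map F phi (g x) - shrink (policy x))
    (solution_map F phi (g x) - shrink (policy x)) <= (eps / 2) ^+ 2.
  apply: le_trans lip _; rewrite -mulmxBr.
  rewrite (_ : 4 * (mu / 8) = mu / 2); last by lra.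
  rewrite ler_pdivrMr; last by rewrite exprn_gt0 // divr_gt0.
  apply: le_trans (hK _) _; apply: le_trans (ler_wpM2l K0 gh) _.
  rewrite /eta -exprMn expr_div_n mulrCA ler_piMr ?sqr_ge0 //.
  rewrite ler_pdivrMr ?mul1r; last by rewrite exprn_gt0 //; lra.
  nra.
have part2 : dotcv (shrink (policy x) - policy x)
    (shrink (policy x) - policy x) <= (eps / 2) ^+ 2.
  rewrite /shrink addrC addKr dotcvZl dotcvZr -opprB dotcvNl dotcvNr opprK.
  rewrite mulrA -expr2; apply: le_trans (ler_wpM2l (sqr_ge0 _) (hQ _ Xx)) _.
  rewrite expr_div_n mulrAC -mulrA ler_piMr ?sqr_ge0 //.
  rewrite ler_pdivrMr ?mul1r; last by rewrite exprn_gt0.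
  nra.
rewrite /= -(subrKA (shrink (policy x))).
apply: le_trans (dotcvD_le _ _) _; nra.
Qed.
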